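(* Let $t_1,t_2$ be two transactions such that $t_2$ is sent $\omega\ge 0$ time after $t_1$, i.e. $\sigma(t_2)=\sigma(t_1)+\omega$, and let $\mathcal{O}$ be a set of $n$ observers logging network events. Then for every integer $m$ with $0\le m\le n$, the probability that exactly $m$ out of the $n$ observers receive transaction $t_1$ before $t_2$ is $$\mathbb{Q}_n(m)=\Pr\Big[\,m=\big|\{o\in\mathcal{O}\ :\ t_1\prec_o t_2\}\big|\,\Big]=\binom{n}{m}\left(\int_0^\infty F(\omega+\iota)\,f(\iota)\,d\iota\right)^{m}\left(1-\int_0^\infty F(\omega+\iota)\,f(\iota)\,d\iota\right)^{n-m}.$$
   Context: For a transaction $t$, $\sigma(t)\in\mathbb{R}$ denotes the (deterministic) time at which $t$ is sent. For an observer $o\in\mathcal{O}$, the propagation time $\tau_o(t)$ is a nonnegative real random variable: the time it takes to deliver $t$ from its sender to $o$. So $o$ receives $t$ at time $\sigma(t)+\tau_o(t)$. The notation $t_1\prec_o t_2$ denotes the event that observer $o$ receives $t_1$ before $t_2$, i.e. $\sigma(t_1)+\tau_o(t_1)<\sigma(t_2)+\tau_o(t_2)$, equivalently $\tau_o(t_1)<\omega+\tau_o(t_2)$. Standing assumptions: all propagation times $\tau_o(t)$ (for $o\in\mathcal{O}$ and $t\in\{t_1,t_2\}$) follow one common distribution $\mathcal{D}^{(r)}$ on $[0,\infty)$, which has probability density function $f$ and cumulative distribution function $F$ (so $F(T)=\Pr[\tau_o(t)\le T]$). The family $(\tau_o(t))_{o\in\mathcal{O},\,t\in\{t_1,t_2\}}$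 is mutually independent. *)

(* Defs.v *)
From HB Require Import structures.
From mathcomp Require Import all_boot all_order all_algebra finmap.
From mathcomp Require Import all_classical all_reals all_analysis.

Set Implicit Arguments.
Unset Strict Implicit.
Unset Printing Implicit Defensive.

Import Order.TTheory GRing.Theory Num.Theory.
Import numFieldNormedType.Exports.

Local Open Scope classical_set_scope.
Local Open Scope ring_scope.

(* Mutual independence of the subfamily (X i)_(i in K): the product rule for
   every finite set J of indices in K and all Borel sets A i. *)
Definition mutually_independent (d : measure_display) (T : measurableType d)
    (R : realType) (P : probability T R) (I : choiceType) (K : set I)
    (X : I -> {RV P >-> R}) : Prop :=
  forall (J : {fset I}) (A : I -> set R),
    [set` J] `<=` K -> (forall i, i \in J -> measurable (A i)) ->
    P (\bigcap_(i in [set` J]) (X i @^-1` A i)) =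
    (\prod_(i <- J) P (X i @^-1` A i))%E.

(* Agreement is required on Borel sets only: elsewhere the values of a measure
   are junk. *)
Definition has_law (d : measure_display) (T : measurableType d)
    (R : realType) (P : probability T R) (X : {RV P >-> R})
    (D : probability (measurableTypeR R) R) : Prop :=
  forall A : set R, measurable A -> distribution P X A = D A.

Definition is_density (R : realType) (D : probability (measurableTypeR R) R)
    (f : R -> R) : Prop :=
  [/\ measurable_fun [set: R] f,
      forall x, 0 <= f x &
      forall A : set R, measurable A ->
        D A = (\int[lebesgue_measure]_(x in A) (f x)%:E)%E].

(* The library's cdf is attached to a random variable; this is the same
   function for a law on the real line, with values in R. *)
Definition law_cdf (R : realType) (D : probability (measurableTypeR R) R)
    (x : R) : R :=
  fine (D `]-oo, x]%classic).

Definition receives_before (d : measure_display) (T : measurableType d)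
    (R : realType) (P : probability T R) (O Tx : Type) (sigma : Tx -> R)
    (tau : O -> Tx -> {RV P >-> R}) (t1 t2 : Tx) (o : O) (w : T) : bool :=
  sigma t1 + tau o t1 w < sigma t2 + tau o t2 w.

Definition prob_exactly (d : measure_display) (T : measurableType d)
    (R : realType) (P : probability T R) (O : finType) (Tx : Type)
    (sigma : Tx -> R) (tau : O -> Tx -> {RV P >-> R}) (t1 t2 : Tx)
    (m : nat) : \bar R :=
  P [set w | m = #|[set o : O | receives_before sigma tau t1 t2 o w]%SET|].

(* Main.v *)
Require Import Defs.
From HB Require Import structures.
From mathcomp Require Import all_boot all_order all_algebra finmap.
From mathcomp Require Import all_classical all_reals all_analysis.
From mathcomp Require Import measurable_realfun.

Set Implicit Arguments.
Unset Strict Implicit.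
Unset Printing Implicit Defensive.

Import Order.TTheory GRing.Theory Num.Theory.
Import numFieldNormedType.Exports.

Local Open Scope classical_set_scope.
Local Open Scope ring_scope.

(** The pairs [(tau o t2, tau o t1)], [o] ranging over the observers, are
    independent with common law the product measure [D \x D]: the hypothesis
    gives the product rule on rectangles, and it extends to all measurable sets
    by replacing one factor at a time, each step being the uniqueness of a
    finite measure given on a generating pi-system. Hence the events
    "[o] receives [t1] before [t2]" are independent, and Fubini together with
    the absence of atoms of [D] gives each of them the probability
    [\int F (omega + x) * f x]. The number of successes is then obtained by
    summing over the sets of successful observers. *)

Lemma product_rule_generated (d : measure_display) (T : measurableType d)
    (R : realType) (P : probability T R) (I : finType)
    (d' : measure_display) (U : measurableType d') (Z : I -> T -> U)
    (nu : I -> {finite_measure set U -> \bar R})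
    (G : set (set U)) :
  (forall i, measurable_fun setT (Z i)) ->
  measurable = <<s G >> -> setI_closed G -> G setT ->
  (forall B : I -> set U, (forall i, G (B i)) ->
    P (\bigcap_i (Z i @^-1` B i)) = (\prod_i nu i (B i))%E) ->
  forall B : I -> set U, (forall i, measurable (B i)) ->
    P (\bigcap_i (Z i @^-1` B i)) = (\prod_i nu i (B i))%E.
Proof.
move=> mZ mG GI GT ruleG.
have Gm A : G A -> measurable A.
  by move=> GA; rewrite mG; exact: sub_sigma_algebra.
(* The list [s] holds the indices at which [B] may already be any measurable set; at the others it
   stays in [G]. The induction starts from [ruleG] and ends at [enum I]. *)
suff rule (s : seq I) (B : I -> set U) : (forall i, measurable (B i)) ->
    (forall i, i \notin s -> G (B i)) ->
    P (\bigcap_i (Z i @^-1` B i)) = (\prod_i nu i (B i))%E.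
  by move=> B mB; apply: (rule (enum I)) => // i; rewrite mem_enum.
elim: s B => [|j s IH] B mB GB; first by apply: ruleG => i; exact: GB.
pose E := \bigcap_(i in [set i | i != j]) (Z i @^-1` B i).
have mE : measurable E.
  apply: fin_bigcap_measurable => [|i _]; first exact: finite_finset.
  by rewrite -[X in measurable X]setTI; exact: mZ.
pose B' C i := if i == j then C else B i.
have capE C : \bigcap_i (Z i @^-1` B' C i) = Z j @^-1` C `&` E.
  apply/seteqP; split => [w h|w [hj h] i _].
    split; first by have := h j Logic.I; rewrite /B' eqxx.
    by move=> i ij; have := h i Logic.I; rewrite /B' (negbTE ij).
  by rewrite /B'; case: eqVneq => [->|ij] //; exact: h.
have c_ge0 : 0 <= fine (\prod_(i | i != j) nu i (B i))%E.
  by apply: fine_ge0; apply: prode_ge0.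
pose c := NngNum c_ge0.
have cE : c%:num%:E = (\prod_(i | i != j) nu i (B i))%E.
  by rewrite /= fineK//; apply: prode_fin_num => i _; exact: fin_num_measure.
have prodE C : (\prod_i nu i (B' C i) = c%:num%:E * nu j C)%E.
  rewrite (bigD1 j)//= {1}/B' eqxx muleC -cE; congr (_ * _)%E.
  by rewrite cE; apply: eq_bigr => i ij; rewrite /B' (negbTE ij).
(* With the other factors frozen, both sides are finite measures of the [j]-th set: the image under
   [Z j] of [P] restricted to [E], and [nu j] scaled by [c]. On [G] they agree by the induction
   hypothesis. *)
pose m1 : {measure set U -> \bar R} := pushforward (mrestr P mE) (Z j).
pose m2 : {measure set U -> \bar R} := mscale c (nu j).
have BE : B = B' (B j).
  by apply/funext => i; rewrite /B'; case: eqVneq => [->|].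
rewrite BE capE prodE -/(m1 (mZ j) (B j)) -/(m2 (B j)).
apply: (measure_unique G (fun=> setT) mG GI _ _ (m1 (mZ j)) m2) => //.
- by rewrite bigcup_const.
- move=> A GA; rewrite -[LHS]/(P (Z j @^-1` A `&` E)) -[RHS]/(_ * _)%E.
  rewrite -capE -prodE; apply: IH => i.
    by rewrite /B'; case: eqP => // _; exact: Gm.
  rewrite /B'; case: eqVneq => // ij is'; apply: GB.
  by rewrite inE negb_or ij.
- move=> _; rewrite -[X in (X < _)%E]/(P (Z j @^-1` setT `&` E)).
  by rewrite ltey_eq fin_num_measure// preimage_setT setTI.
Qed.

Lemma binomial_of_product_rule (d : measure_display) (T : measurableType d)
    (R : realType) (P : probability T R) (I : finType) (e : I -> T -> bool)
    (q : R) (m : nat) :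
  (forall i, measurable [set w | e i w]) ->
  (forall S : {set I}, P (\bigcap_i [set w | e i w = (i \in S)]) =
    (\prod_i (if i \in S then q else 1 - q)%:E)%E) ->
  P [set w | m = #|[set i | e i w]%SET|] =
    ('C(#|I|, m)%:R * q ^+ m * (1 - q) ^+ (#|I| - m))%:E.
Proof.
move=> me ruleP.
(* [F S] says that the set of successes is exactly [S]. These events are disjoint, and those with
   [S] of cardinality [m], ['C(#|I|, m)] in number, all have the same probability. *)
pose F (S : {set I}) := \bigcap_i [set w | e i w = (i \in S)].
have FE S w : F S w <-> [set i | e i w]%SET = S.
  split=> [h|<- i _ /=]; last by rewrite inE.
  by apply/setP => i; rewrite inE; exact: h.
have mF S : measurable (F S).
  apply: fin_bigcap_measurable => [|i _]; first exact: finite_finset.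
  case: (i \in S); first exact: me.
  rewrite [X in measurable X](_ : _ = ~` [set w | e i w]).
    exact: measurableC.
  by apply/seteqP; split => w /= => [->|/negP/negbTE].
have -> : [set w | m = #|[set i | e i w]%SET|] =
    \bigcup_(S in [set` [pred S : {set I} | #|S| == m]]) F S.
  apply/seteqP; split => w /=.
    by move=> mE; exists [set i | e i w]%SET; [apply/eqP | apply/FE].
  by move=> [S /= /eqP <-] /FE ->.
rewrite measure_fin_bigcup//; last first.
  by move=> S S' _ _ [w [/FE <- /FE <-]].
rewrite -(@bigfs _ _ _ _ (index_enum _) [pred S : {set I} | #|S| == m])
  ?index_enum_uniq//; last first.
  by move=> S _; rewrite mem_index_enum.
rewrite (eq_bigr (fun=> (q ^+ m * (1 - q) ^+ (#|I| - m))%:E)) => [|S /= /eqP Sm].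
  rewrite sumEFin big_const iter_addr_0 -mulrA mulr_natl -card_draws.
  by congr (_ *+ _)%:E; apply: eq_card => S; rewrite inE.
rewrite ruleP prodEFin (bigID (mem S))/=.
rewrite (eq_bigr (fun=> q)) => [|i ->//].
rewrite [in X in _ * X](eq_bigr (fun=> 1 - q)) => [|i /negbTE ->//].
rewrite !prodr_const Sm; congr (_ * _ ^+ _)%:E.
by rewrite -Sm -(cardC (mem S)) addKn; exact: eq_card.
Qed.

(** Absolute continuity serves twice: it makes the Radon-Nikodym derivative of [D] available, and it
    makes single points [D]-null. *)
Lemma density_dominated (R : realType) (D : probability (measurableTypeR R) R)
    (f : R -> R) : is_density D f -> D `<< lebesgue_measure.
Proof.
move=> [mf _ fD]; apply/null_content_dominatesP => A mA A0.
rewrite fD// null_set_integral//.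
exact/measurable_EFinP/measurable_funTS.
Qed.

(** Change of variables holds for the Radon-Nikodym derivative of [D], and [f] equals that
    derivative almost everywhere on [U] because both have integral [D E] over each measurable [E]
    inside [U]. *)
Lemma integral_density (R : realType) (D : probability (measurableTypeR R) R)
    (f : R -> R) (U : set R) (g : R -> \bar R) :
  is_density D f -> measurable U -> D.-integrable U g ->
  (\int[D]_(x in U) g x = \int[lebesgue_measure]_(x in U) (g x * (f x)%:E))%E.
Proof.
move=> Df mU ig; have domD := density_dominated Df; have [mf _ fD] := Df.
have mg := measurable_int _ ig.
rewrite -(@Radon_Nikodym_change_of_variables _ _ _ D _ domD)//.
have irn := @Radon_Nikodym_integrable _ _ _ (charge_of_finite_measure D) _ domD.
apply: ae_eq_integral => //.
- by apply: emeasurable_funM => //; apply: measurable_funTS; exact: measurable_int irn.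
- by apply: emeasurable_funM => //; exact/measurable_funTS/measurable_EFinP.
apply: ae_eqe_mul2l; apply: integral_ae_eq => //.
- exact: integrableS irn.
- exact/measurable_funTS/measurable_EFinP.
by move=> E EU mE; rewrite -fD// -Radon_Nikodym_integral.
Qed.

Lemma product_measure_lt (R : realType) (D : probability (measurableTypeR R) R)
    (f : R -> R) (c : R) : is_density D f -> D `[0, +oo[%classic = 1%E ->
  (D \x D)%E [set z : R * R | z.2 < c + z.1] =
  (\int[lebesgue_measure]_(x in `[0, +oo[) (law_cdf D (c + x) * f x))%:E.
Proof.
move=> Df D0.
have /null_content_dominatesP domD := density_dominated Df.
have DE y : D `]-oo, y]%classic = (law_cdf D y)%:E.
  by rewrite /law_cdf fineK// fin_num_measure.
(* The strict inequality in the event yields open half-lines, the distribution function closed ones;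
   they differ by a null point. *)
have Dlt y : D `]-oo, y[%classic = (law_cdf D y)%:E.
  rewrite -DE -(@setUitv1 _ _ -oo%O y true)// measureU0//.
  by apply: domD => //; exact: lebesgue_measure_set1.
have F_ge0 y : 0 <= law_cdf D y by rewrite fine_ge0.
have F_le1 y : law_cdf D y <= 1 by rewrite -lee_fin -DE probability_le1.
have mF : measurable_fun [set: R] (fun x => law_cdf D (c + x)).
  apply: nondecreasing_measurable => // x y xy.
  by rewrite -lee_fin -!DE le_measure ?inE//; apply: subset_itvl; rewrite bnd_simp lerD2l.
(* The product measure integrates the masses of sections; the section at [x] is the open half-line
   below [c + x]. *)
transitivity (\int[D]_x (law_cdf D (c + x))%:E)%E.
  apply: eq_integral => x _; rewrite -Dlt /=; congr (D _).
  by apply/seteqP; split => y; rewrite /xsection/= in_itv/= inE.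
have iF U : measurable U -> D.-integrable U (fun x => (law_cdf D (c + x))%:E).
  move=> mU; apply: (@le_integrable _ _ _ D _ mU _ (cst 1%E)).
  - exact/measurable_funTS/measurable_EFinP.
  - by move=> x _; rewrite /= lee_fin !ger0_norm.
  - exact: finite_measure_integrable_cst.
(* [D] gives no mass to the negative half-line, so the domain shrinks to [[0, +oo[] before [D] is
   traded for its density. *)
rewrite (@ge0_negligible_integral _ _ _ D _ `]-oo, 0[%classic)//; last 3 first.
- exact/measurable_EFinP.
- by move=> x _; rewrite lee_fin.
- have := probability_setC D (measurable_itv `[0, +oo[).
  by rewrite setCitvr D0 subee.
rewrite setTD setCitvl.
(* The real integral is [fine] of the extended one; integrability rules out the default value at
   infinity. *)
rewrite /Rintegral.
under [in RHS]eq_integral do rewrite EFinM.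
by rewrite -(integral_density Df)//= ?fineK ?integrable_fin_num//; exact: iF.
Qed.

(** Independence is applied to the finite set [J] of all pairs of an observer with [s] or [t], and
    the product over [J] is regrouped by observer. As [s != t], no index repeats and [C] is free to
    differ at [s] and [t]. *)
Lemma indep_pairs_rectangle_rule (d : measure_display) (T : measurableType d)
    (R : realType) (P : probability T R) (O : finType) (Tx : choiceType)
    (X : O -> Tx -> {RV P >-> R}) (s t : Tx)
    (D : probability (measurableTypeR R) R) (A B : O -> set R) :
  s != t -> (forall o u, u \in [:: s; t] -> has_law (X o u) D) ->
  mutually_independent [set i : O * Tx | i.2 \in [:: s; t]]
    (fun i => X i.1 i.2) ->
  (forall o, measurable (A o)) -> (forall o, measurable (B o)) ->
  P (\bigcap_o (X o s @^-1` A o `&` X o t @^-1` B o)) =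
  (\prod_o (D (A o) * D (B o)))%E.
Proof.
move=> st lawX indX mA mB.
pose r := [seq (o, u) | o <- enum O, u <- [:: s; t]].
pose J : {fset O * Tx} := seq_fset tt r.
have rP o u : ((o, u) \in J) = (u \in [:: s; t]).
  rewrite seq_fsetE; apply/allpairsP/idP => [|ut]; last first.
    by exists (o, u); rewrite mem_enum.
  by case=> -[x y] [_ /= ? [_ ->]].
pose C (i : O * Tx) := if i.2 == s then A i.1 else B i.1.
have mC i : measurable (C i) by rewrite /C; case: ifP.
have Cs o : C (o, s) = A o by rewrite /C eqxx.
have Ct o : C (o, t) = B o by rewrite /C eq_sym (negbTE st).
have := indX J C _ (fun i _ => mC i).
have -> : \bigcap_(i in [set` J]) (X i.1 i.2 @^-1` C i) =
    \bigcap_o (X o s @^-1` A o `&` X o t @^-1` B o).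
  apply/seteqP; split => w h.
    move=> o _; split.
      by rewrite -Cs; apply: (h (o, s)); rewrite /= rP !inE eqxx.
    by rewrite -Ct; apply: (h (o, t)); rewrite /= rP !inE eqxx orbT.
  move=> [x u] /=; rewrite rP !inE => /orP[] /eqP ->.
    by rewrite Cs; have [] := h x Logic.I.
  by rewrite Ct; have [] := h x Logic.I.
move=> -> => [|[x u] /=]; last by rewrite rP.
have ur : uniq r.
  apply: allpairs_uniq; rewrite ?enum_uniq//=; first by rewrite inE st.
  by move=> [? ?] [? ?] _ _.
rewrite (perm_big _ (seq_fset_perm tt r)) undup_id// big_allpairs_dep big_enum /=.
apply: eq_bigr => o _; rewrite !big_cons big_nil mule1 Cs Ct.
by congr (_ * _)%E; apply: lawX => //; rewrite !inE eqxx ?orbT.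
Qed.

Theorem theorem1 (R : realType) (d : measure_display) (T : measurableType d)
    (P : probability T R)
    (Tx : choiceType) (O : finType) (n : nat) (cardO : #|O| = n)
    (sigma : Tx -> R) (tau : O -> Tx -> {RV P >-> R})
    (tau_ge0 : forall o t, {ae P, forall w, 0 <= tau o t w})
    (t1 t2 : Tx) (t1_neq_t2 : t1 != t2)
    (omega : R) (omega_ge0 : 0 <= omega) (sigma_t2 : sigma t2 = sigma t1 + omega)
    (D : probability (measurableTypeR R) R) (D_ge0 : D `[0, +oo[%classic = 1%E)
    (f : R -> R) (f_density : is_density D f)
    (tau_law : forall o t, t \in [:: t1; t2] -> has_law (tau o t) D)
    (tau_indep : mutually_independent [set i : O * Tx | i.2 \in [:: t1; t2]]
                   (fun i => tau i.1 i.2))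
    (m : nat) (le_mn : (m <= n)%N) :
  let F := law_cdf D in
  let p := \int[lebesgue_measure]_(x in `[0, +oo[) (F (omega + x) * f x) in
  prob_exactly sigma tau t1 t2 m =
    ('C(n, m)%:R * p ^+ m * (1 - p) ^+ (n - m))%:E.
Proof.
move=> F p.
(* [V] and [R] have the same measurable sets, but with distinct displays, which
   unification does not identify. *)
pose V := measurableTypeR R.
pose Z o w : V * V := (tau o t2 w, tau o t1 w).
have mtau o t : measurable_fun setT (tau o t : T -> V).
  by move=> _ Y mY; exact: (@measurable_funP _ _ _ _ setT (tau o t) measurableT Y mY).
have mZ o : measurable_fun setT (Z o) by exact: measurable_fun_pair.
(* Since [Z] puts the time of [t2] first, the section of [L] at [x] constrains the time of [t1] and
   has mass [F (omega + x)]. *)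
pose L : set (V * V) := [set z | z.2 < omega + z.1].
have mL : measurable L.
  have m1 : measurable_fun setT (fst : V * V -> R).
    by move=> _ Y mY; exact: (measurable_fst measurableT).
  have m2 : measurable_fun setT (snd : V * V -> R).
    by move=> _ Y mY; exact: (measurable_snd measurableT).
  have mlt : measurable_fun setT (fun z : V * V => z.2 < omega + z.1).
    by apply: measurable_fun_ltr => //; exact: measurable_funD.
  by rewrite -[L]setTI; exact: (mlt measurableT [set true]).
have LE o w : receives_before sigma tau t1 t2 o w <-> L (Z o w).
  by rewrite /receives_before sigma_t2 -addrA ltrD2l.
pose DD : {finite_measure set (V * V)%type -> \bar R} :=
  product_subprobability ((D : subprobability V R), (D : subprobability V R)).
have DDL : DD L = p%:E by exact: product_measure_lt.
have DDT : DD setT = 1%E.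
  by rewrite -setXTT [LHS]product_measure1E//= probability_setT mule1.
have DDLC : DD (~` L) = (1 - p)%:E.
  rewrite -setTD measureD// ?setTI.
    by rewrite EFinB; congr (_ - _)%E; [exact: DDT|exact: DDL].
  by rewrite ltey_eq fin_num_measure.
pose G : set (set (V * V)) := [set A `*` B | A in measurable & B in measurable].
have GI : setI_closed G.
  move=> _ _ [A mA [B mB <-]] [A' mA' [B' mB' <-]].
  exists (A `&` A'); first exact: measurableI.
  by exists (B `&` B'); [exact: measurableI|rewrite setXI].
have GT : G setT by exists setT => //; exists setT => //; rewrite setXTT.
have ruleG (B : O -> set (V * V)) : (forall o, G (B o)) ->
    P (\bigcap_o (Z o @^-1` B o)) = (\prod_o DD (B o))%E.
  move=> GB.
  have /choice[A AP] : forall o, exists A, measurable A /\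
      exists2 A', measurable A' & A `*` A' = B o.
    by move=> o; have [A mA ?] := GB o; exists A.
  have /choice[A' A'P] : forall o, exists A',
      measurable A' /\ A o `*` A' = B o.
    by move=> o; have [_ [A' mA' ?]] := AP o; exists A'.
  (* The rectangle rule is used with [t1] first, opposite to [Z]; hence the swap here and [muleC]
     below. *)
  transitivity (P (\bigcap_o (tau o t1 @^-1` A' o `&` tau o t2 @^-1` A o))).
    congr (P _); apply: eq_bigcapr => o _; rewrite -(A'P o).2.
    by rewrite setIC.
  rewrite (indep_pairs_rectangle_rule t1_neq_t2 tau_law tau_indep).
  - apply: eq_bigr => o _; rewrite -(A'P o).2 muleC [RHS]product_measure1E//.
    + exact: (AP o).1.
    + exact: (A'P o).1.
  - by move=> o; exact: (A'P o).1.
  - by move=> o; exact: (AP o).1.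
rewrite /prob_exactly -cardO.
apply: binomial_of_product_rule => [i|S].
  have -> : [set w | receives_before sigma tau t1 t2 i w] = Z i @^-1` L.
    by apply/funext => w; apply/propext; exact: LE.
  by rewrite -[X in measurable X]setTI; exact: mZ.
(* A pattern [S] of successes prescribes [L] or its complement for each pair. Neither is given as a
   rectangle, so [ruleG] has to be extended to all measurable sets. *)
transitivity (P (\bigcap_o (Z o @^-1` (if o \in S then L else ~` L)))).
  congr (P _); apply: eq_bigcapr => o _; apply/funext => w; apply/propext.
  rewrite /preimage/=; case: (o \in S); first exact: LE.
  split=> [h /LE|h]; first by rewrite h.
  by apply/negP => /LE.
rewrite (product_rule_generated mZ (measurable_prod_measurableType _ _) GI GT
  ruleG).
  by apply: eq_bigr => o _; case: (o \in S); [exact: DDL|exact: DDLC].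
by move=> o; case: (o \in S) => //; exact: measurableC.
Qed.
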